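(* Let $Q:U\to H$ and $Q_n:U\to H$, $n\in\mathbb{N}$, be weakly sequentially closed operators with $$\|Q(u)-Q_n(u)\|_H\le\epsilon_n\quad\text{for all }u\in\mathcal{C}_{ad},\qquad\epsilon_n\downarrow0.$$ For each $n$ let $u_n$ be a minimizer of $\tfrac12\|Q_n(u)-g\|_H^2+\tfrac\alpha2\|u\|_U^2$ over $\mathcal{C}_{ad}$, and let $\bar u$ be a minimizer of $\mathcal{J}(u):=\tfrac12\|Q(u)-g\|_H^2+\tfrac\alpha2\|u\|_U^2$ over $\mathcal{C}_{ad}$. Suppose that $Q$ is Fréchet differentiable and that there is $L_1>0$ with $$\|Q'(u_a)-Q'(u_b)\|_{\mathcal{L}(U,H)}\le L_1\|u_a-u_b\|_U\quad\text{for all }u_a,u_b\in\mathcal{C}_{ad},\qquad L_1\|Q(\bar u)-g\|_H<\alpha.$$ If $\mathcal{J}'(\bar u)=0$, then for sufficiently large $n\in\mathbb{N}$ $$\|u_n-\bar u\|_U\le\sqrt{\frac{3}{\alpha-L_1\|g-Q(\bar u)\|_H}}\;\sqrt{\epsilon_n^2+2\|Q(\bar u)-g\|_H^2}.$$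
   Context: $U$ and $H$ are Hilbert spaces, $g\in H$, $\alpha>0$, and $\mathcal{C}_{ad}\subset U$ is a nonempty, closed and convex set. An operator $Q:U\to H$ is weakly sequentially closed if $u_n\rightharpoonup u$ weakly in $U$ and $Q(u_n)\rightharpoonup\bar g$ weakly in $H$ imply $\bar g=Q(u)$. $Q'(u)\in\mathcal{L}(U,H)$ and $\mathcal{J}'(u)\in U^*$ denote Fréchet derivatives. *)

(* Defs.v *)
From HB Require Import structures.
From mathcomp Require Import all_boot all_order all_algebra sesquilinear.
From mathcomp Require Import all_classical all_reals all_analysis.

Set Implicit Arguments.
Unset Strict Implicit.
Unset Printing Implicit Defensive.

Import Order.TTheory GRing.Theory Num.Theory.
Import numFieldNormedType.Exports.

Local Open Scope classical_set_scope.
Local Open Scope ring_scope.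

HB.mixin Record CompleteNormedModule_isHilbert (R : realType) V
    & CompleteNormedModule R V := {
  inner : {dot V for (@idfun R)} ;
  norm_inner : forall x : V, `|x| = Num.sqrt (inner x x)
}.

#[short(type="hilbertType")]
HB.structure Definition Hilbert (R : realType) :=
  {V of CompleteNormedModule R V & CompleteNormedModule_isHilbert R V}.

Section definitions.
Context {R : realType}.

Definition weak_cvg (V : normedModType R) (u : V ^nat) (l : V) : Prop :=
  forall f : {linear V -> R^o}, continuous f -> f (u n) @[n --> \oo] --> f l.

Definition weakly_seq_closed (V W : normedModType R) (Q : V -> W) : Prop :=
  forall (u : V ^nat) (l : V) (y : W),
    weak_cvg u l -> weak_cvg (Q \o u) y -> y = Q l.

(* [sup] of an unbounded set is 0 by convention, so this is the operator norm
   only for bounded linear [f]. *)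
Definition opnorm (V W : normedModType R) (f : V -> W) : R :=
  sup [set `|f x| | x in [set x : V | `|x| <= 1]].

Definition minimizer_on (T : Type) (C : set T) (F : T -> R) (x : T) : Prop :=
  C x /\ forall y, C y -> F x <= F y.

(* The codomain is [R^o] so that the functional has a Frechet differential. *)
Definition tikhonov (V W : normedModType R) (Q : V -> W) (g : W) (alpha : R)
    (u : V) : R^o :=
  2^-1 * `|Q u - g| ^+ 2 + alpha / 2 * `|u| ^+ 2.

End definitions.

(* Main.v *)
Require Import Defs.
From HB Require Import structures.
From mathcomp Require Import all_boot all_order all_algebra sesquilinear.
From mathcomp Require Import all_classical all_reals all_analysis.
From mathcomp Require Import ring lra.

Set Implicit Arguments.
Unset Strict Implicit.
Unset Printing Implicit Defensive.

Import Order.TTheory GRing.Theory Num.Theory.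
Import numFieldNormedType.Exports.

Local Open Scope classical_set_scope.
Local Open Scope ring_scope.

(** Write [h = u_n - ubar], [e = Q ubar - g], [r = |e|] and [D] for the
derivative of [Q] at [ubar].

The proof compares the value of the perturbed functional at [u_n] with its
value at [ubar].  Expanding all squared norms around [ubar], the minimality of
[u_n] bounds [alpha/2 |h|^2] by perturbation terms minus
[<e, Q u_n - Q ubar> + alpha <ubar, h>].  Two facts control the latter:

- the first-order condition [<e, D h> + alpha <ubar, h> >= 0]
  ([first_order_optimality]).  It is taken in the form of a variational
  inequality, obtained from the minimality of [ubar] over the convex set by
  moving from [ubar] towards [u_n];

- the Taylor bound [|Q u_n - Q ubar - D h| <= L1/2 |h|^2]
  ([quadratic_remainder]), which holds because the segment from [ubar] to [u_n]
  stays in the convex set, where the derivative of [Q] is [L1]-Lipschitz.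

Together they leave only [L1 r / 2 |h|^2], which the smallness condition
[L1 r < alpha] absorbs into the left-hand side.  The perturbation terms
amount to [2 r eps_n + eps_n^2 / 2], whence, in [tikhonov_stability],

  [(alpha - L1 r) |h|^2 <= 4 r eps_n + eps_n^2].

The right-hand side is at most [3 (eps_n^2 + 2 r^2)] because
[4 r eps_n <= 2 r^2 + 2 eps_n^2]; taking square roots gives the claim, for
every [n]. *)

(** * Inner products *)

(** The codomain is [R] itself, so that the order of [R] applies directly,
instead of the scalar ring of the underlying module. *)
Definition ip (R : realType) (V : hilbertType R) (x y : V) : R := inner x y.

Local Notation "''[' x , y ]" := (ip x y) : ring_scope.

Section inner_product.
Context {R : realType} {V : hilbertType R}.
Implicit Types x y z : V.

Lemma ipC x y : '[x, y] = '[y, x].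
Proof. by rewrite /ip (hermC (inner : {dot V for (@idfun R)})) expr0 mul1r. Qed.

Lemma ip_linear x : linear (ip x : V -> R^o).
Proof. by move=> a y z; rewrite /ip linearPr. Qed.

HB.instance Definition _ x := GRing.isLinear.Build R V R^o _ _ (ip_linear x).

Lemma ipZr a x y : '[x, a *: y] = a * '[x, y].
Proof. by rewrite linearZ. Qed.

Lemma ipZl a x y : '[a *: x, y] = a * '[x, y].
Proof. by rewrite ipC ipZr ipC. Qed.

Lemma ipDr x y z : '[x, y + z] = '[x, y] + '[x, z].
Proof. exact: linearD. Qed.

Lemma ipDl x y z : '[x + y, z] = '[x, z] + '[y, z].
Proof. by rewrite ipC ipDr !(ipC z). Qed.

Lemma ipNr x y : '[x, - y] = - '[x, y].
Proof. exact: linearN. Qed.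

Lemma ip_ge0 x : 0 <= '[x, x].
Proof.
have [->|x0] := eqVneq x 0; first by rewrite linear0.
by apply/ltW/(neq0_dnorm_gt0 (s := (inner : {dot V for (@idfun R)}))).
Qed.

Lemma ip_normE x : '[x, x] = `|x| ^+ 2.
Proof. by rewrite norm_inner sqr_sqrtr ?ip_ge0. Qed.

Lemma sqr_normD x y : `|x + y| ^+ 2 = `|x| ^+ 2 + 2 * '[x, y] + `|y| ^+ 2.
Proof. by rewrite -!ip_normE ipDr !ipDl (ipC y x); ring. Qed.

(** Cauchy-Schwarz, read off from the nonnegativity of
[| |y| x - |x| y |^2 = 2 |x| |y| (|x| |y| - '[x, y])]. *)
Lemma ip_le x y : '[x, y] <= `|x| * `|y|.
Proof.
have [->|y0] := eqVneq y 0; first by rewrite linear0 normr0 mulr0.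
have [->|x0] := eqVneq x 0; first by rewrite ipC linear0 normr0 mul0r.
have := ip_ge0 (`|y| *: x - `|x| *: y).
rewrite ip_normE sqr_normD normrN !normrZ !normr_id ipNr ipZl ipZr.
have xp : 0 < `|x| by rewrite normr_gt0.
have yp : 0 < `|y| by rewrite normr_gt0.
move=> H; rewrite -subr_ge0.
rewrite -(@pmulr_rge0 _ (2 * `|x| * `|y|)) ?mulr_gt0//.
lra.
Qed.

Lemma ip_continuous x : continuous (ip x : V -> R^o).
Proof.
apply: bounded_linear_continuous.
apply/linear_boundedP; exists `|x|; split; first exact: normr_real.
move=> r xr y; apply: le_trans (_ : `|x| * `|y| <= _); last first.
  by rewrite ler_wpM2r// ltW.
by rewrite ler_norml ip_le andbT lerNl -ipNr -(normrN y) ip_le.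
Qed.

End inner_product.

(** * Calculus along segments *)

(** Continuity of [f] makes the set whose supremum is [opnorm f] bounded; for an
unbounded set that supremum would be [0] and the inequality would fail. *)
Lemma le_opnorm (R : realType) (V W : normedModType R) (f : {linear V -> W})
    (x : V) : continuous f -> `|f x| <= opnorm f * `|x|.
Proof.
move=> /linear_lipschitz [k k0 fk].
have [->|x0] := eqVneq x 0; first by rewrite linear0 !normr0 mulr0.
have xp : 0 < `|x| by rewrite normr_gt0.
rewrite -ler_pdivrMr// mulrC -[`|x|^-1]gtr0_norm ?invr_gt0// -normrZ -linearZ.
apply: ub_le_sup => /=.
  exists k => _ [y y1 <-]; rewrite (le_trans (fk _))//.
  by rewrite ler_piMr// ltW.
by exists (`|x|^-1 *: x) => //; rewrite normrZ normfV normr_id mulVf// gt_eqF.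
Qed.

Lemma convex_set_segment (R : realType) (V : lmodType R) (C : set V) (a b : V)
    (t : R) : convex_set C -> C a -> C b -> 0 <= t <= 1 ->
  C (a + t *: (b - a)).
Proof.
move=> Cc Ca Cb /andP[t0 t1].
have := Cc b a (Itv01 t0 t1); rewrite !inE => /(_ Cb Ca).
by rewrite /conv/= /unstable.onem scalerBl scale1r scalerBr addrCA.
Qed.

Section segments.
Context {R : realType} {U H : hilbertType R}.

Lemma is_derive_line (Q : U -> H) (e : H) (a h : U) (t : R) :
  differentiable Q (a + t *: h) ->
  is_derive t 1 (fun s : R => '[e, Q (a + s *: h)] : R^o)
    '[e, 'd Q (a + t *: h) h].
Proof.
move=> dQ.
pose line (s : R) : U := a + s *: h.
have dline : is_diff t line ( *:%R^~ h).
  by apply: is_diff_eq; rewrite add0r.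
have dQl : is_diff (line t) Q ('d Q (line t)) by exact: differentiableP.
have de : is_diff (Q (line t)) (ip e : H -> R^o) (ip e).
  apply: DiffDef; first exact/linear_differentiable/ip_continuous.
  exact/diff_lin/ip_continuous.
have dall := is_diff_comp dline (is_diff_comp dQl de).
apply: DeriveDef; first exact/diff_derivable/ex_diff.
rewrite deriveE; last exact: ex_diff.
by rewrite diff_val /= scale1r.
Qed.

(** Pairing with the remainder [e] itself turns the vector-valued Taylor bound
into a real one: [psi t = '[e, Q (a + t h) - t D h] - K/2 t^2], where
[D = 'd Q a] and [K = |e| L |h|^2], is nonincreasing on [[0, 1]], since its
derivative [dpsi t = '[e, ('d Q (a + t h) - D) h] - K t] is nonpositive by
Cauchy-Schwarz and the Lipschitz bound.  Then [psi 1 <= psi 0] says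
[|e|^2 <= K / 2]. *)
Lemma quadratic_remainder (C : set U) (Q : U -> H) (L : R) (a b : U) :
  0 <= L -> convex_set C -> (forall u, C u -> differentiable Q u) ->
  (forall u v, C u -> C v -> opnorm ('d Q u \- 'd Q v) <= L * `|u - v|) ->
  C a -> C b ->
  `|Q b - Q a - 'd Q a (b - a)| <= L / 2 * `|b - a| ^+ 2.
Proof.
move=> L0 Cc dQ dQL Ca Cb; set h := b - a; set e := _ - _ - _.
pose K : R := `|e| * (L * `|h| ^+ 2).
pose psi (t : R) := '[e, Q (a + t *: h)] - t * '[e, 'd Q a h] - K / 2 * t ^+ 2.
pose dpsi (t : R) := '[e, 'd Q (a + t *: h) h] - '[e, 'd Q a h] - K * t.
have Ct (t : R) : 0 <= t <= 1 -> C (a + t *: h) by exact: convex_set_segment.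
have dpsiE (t : R) : 0 <= t <= 1 -> is_derive t 1 psi (dpsi t).
  move=> t01; have := is_derive_line e (dQ _ (Ct _ t01)) => dl.
  apply: is_derive_eq; rewrite /dpsi.
  by rewrite /GRing.scale /=; field.
have dpsi_le0 (t : R) : 0 <= t <= 1 -> dpsi t <= 0.
  move=> t01; have Cat := Ct _ t01; rewrite /dpsi -ipNr -ipDr subr_le0.
  apply: (le_trans (ip_le _ _)); rewrite /K -mulrA ler_wpM2l//.
  apply: (@le_trans _ _ (opnorm ('d Q (a + t *: h) \- 'd Q a) * `|h|)).
    apply: (le_opnorm (f := 'd Q (a + t *: h) \- 'd Q a)) => x.
    by apply: continuousB; exact/diff_continuous/dQ.
  have -> : L * `|h| ^+ 2 * t = L * `|a + t *: h - a| * `|h|.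
    rewrite addrAC subrr add0r normrZ ger0_norm; first by ring.
    by case/andP: t01.
  by rewrite ler_wpM2r// dQL.
have : psi 1 <= psi 0.
  apply: (@ler0_derive1_nincr _ psi 0 1) => //.
  - move=> x; rewrite in_itv /= => /andP[/ltW x0 /ltW x1].
    by apply: ex_derive; apply: dpsiE; rewrite x0.
  - move=> x; rewrite in_itv /= => /andP[/ltW x0 /ltW x1].
    have x01 : 0 <= x <= 1 by rewrite x0.
    by rewrite derive1E (@derive_val _ _ _ _ _ _ _ (dpsiE _ x01)) dpsi_le0.
  - apply: derivable_within_continuous => x; rewrite in_itv /= => x01.
    by apply: ex_derive; apply: dpsiE.
have -> : psi 1 = '[e, Q b] - '[e, 'd Q a h] - K / 2.
  by rewrite /psi scale1r (addrC a) /h subrK mul1r expr1n mulr1.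
have -> : psi 0 = '[e, Q a].
  by rewrite /psi scale0r addr0 mul0r expr0n mulr0 !subr0.
have ee : `|e| ^+ 2 = '[e, Q b] - '[e, Q a] - '[e, 'd Q a h].
  by rewrite -ip_normE {2}/e !ipDr !ipNr.
move=> psi10; have {psi10 ee} eK : `|e| ^+ 2 <= K / 2 by rewrite ee; lra.
have [->|e0] := eqVneq e 0; first by rewrite normr0 mulr_ge0// divr_ge0.
move: eK; rewrite /K expr2 -(mulrA `|e| (_ * _)) ler_pM2l ?normr_gt0// => eK.
by rewrite mulrAC.
Qed.

(** * Tikhonov functionals *)

(** The functional does not decrease when one moves from its minimizer [a]
towards [b] inside the convex set, so its difference quotients at [a] in the
direction [b - a] are nonnegative, and so is their limit from the right. *)
Lemma first_order_optimality (C : set U) (Q : U -> H) (g : H) (alpha : R)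
    (a b : U) :
  convex_set C -> minimizer_on C (tikhonov Q g alpha) a -> differentiable Q a ->
  C b -> 0 <= '[Q a - g, 'd Q a (b - a)] + alpha * '[a, b - a].
Proof.
move=> Cc [Ca amin] dQ Cb; set h := b - a; set e := Q a - g.
pose q (t : R) : H := t^-1 *: (Q (a + t *: h) - Q a).
have qcvg : q t @[t --> 0^'+] --> 'd Q a h.
  rewrite -deriveE//; apply: cvg_dnbhs_at_right.
  under eq_fun do rewrite /q (addrC a).
  exact: (diff_derivable dQ).
(* [t * phi t] is the increment of the functional from [a] to [a + t *: h];
   the factor [t] in front of the two squares comes from dividing [t ^+ 2]. *)
pose phi (t : R) : R := '[e, q t] + 2^-1 * (t * `|q t| ^+ 2) +
  (alpha * '[a, h] + alpha / 2 * (t * `|h| ^+ 2)).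
have phicvg : phi t @[t --> 0^'+] -->
    '[e, 'd Q a h] + 2^-1 * (0 * `|'d Q a h| ^+ 2) +
    (alpha * '[a, h] + alpha / 2 * (0 * `|h| ^+ 2)).
  have id0 : (t : R) @[t --> 0^'+] --> (0 : R).
    exact/cvg_at_right_filter/cvg_id.
  apply: cvgD; apply: cvgD.
  - by apply: (cvg_comp _ _ qcvg); exact: ip_continuous.
  - apply: cvgM; first exact: cvg_cst.
    apply: cvgM => //; apply: cvgM; exact: cvg_norm.
  - exact: cvg_cst.
  - apply: cvgM; first exact: cvg_cst.
    by apply: cvgM => //; exact: cvg_cst.
suff : 0 <= '[e, 'd Q a h] + 2^-1 * (0 * `|'d Q a h| ^+ 2) +
  (alpha * '[a, h] + alpha / 2 * (0 * `|h| ^+ 2)).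
  by rewrite !mul0r !mulr0 !addr0.
apply: (cvgr_to_ge phicvg).
near=> t.
have t0 : 0 < t by near: t; exact: nbhs_right_gt.
have t1 : t <= 1 by near: t; exact: nbhs_right_le.
have := amin (a + t *: h) (convex_set_segment Cc Ca Cb _).
rewrite (ltW t0) t1 => /(_ isT).
rewrite /tikhonov.
have -> : Q (a + t *: h) - g = e + t *: q t.
  by rewrite /q scalerA mulfV ?gt_eqF// scale1r /e [RHS]addrC [RHS]addrA subrK.
rewrite -/e (sqr_normD e) (sqr_normD a) !(ipZr t) !(normrZ t) (gtr0_norm t0).
move=> amin_t; rewrite -(pmulr_rge0 _ t0) /phi; lra.
Unshelve. all: by end_near.
Qed.

End segments.

(** The perturbation is felt only at the two minimizers: replacing [Q u] by
[P u] and [Q v] by [P v] costs [|Q u - g| delta] each, by Cauchy-Schwarz, plus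
[delta^2 / 2] for the squared norm of [P u - Q u].  The squared norm of
[P v - Q u] has a favourable sign, so no bound on it is required. *)
Lemma tikhonov_stability (R : realType) (U H : hilbertType R) (g : H)
    (alpha : R) (C : set U) (Q P : U -> H) (delta L : R) (u v : U) :
  convex_set C -> (forall w, C w -> differentiable Q w) -> 0 <= L ->
  (forall w z, C w -> C z -> opnorm ('d Q w \- 'd Q z) <= L * `|w - z|) ->
  (forall w, C w -> `|Q w - P w| <= delta) ->
  minimizer_on C (tikhonov Q g alpha) u ->
  minimizer_on C (tikhonov P g alpha) v ->
  (alpha - L * `|Q u - g|) * `|v - u| ^+ 2 <=
    4 * `|Q u - g| * delta + delta ^+ 2.
Proof.
move=> Cc dQ L0 dQL QP umin [Cv vmin]; have Cu : C u by case: umin.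
have stat := first_order_optimality Cc umin (dQ _ Cu) Cv.
have rem := quadratic_remainder L0 Cc dQ dQL Cu Cv.
move: (vmin _ Cu) stat rem; rewrite /tikhonov.
set h := v - u; set x := Q v - Q u.
set e := Q u - g.
pose d1 := P u - Q u; pose d2 := Q v - P v.
have -> : P u - g = e + d1 by rewrite /e /d1 [RHS]addrC subrKA.
have -> : P v - g = e + (x - d2).
  rewrite /e /x /d2 opprB (addrC (_ - _) (P v - _)) subrKA.
  by rewrite [RHS]addrC subrKA.
have -> : v = u + h by rewrite /h addrC subrK.
rewrite (sqr_normD e) (sqr_normD e) (sqr_normD u) ipDr ipNr => vmin_u stat rem.
have d1_le : `|d1| <= delta by rewrite distrC QP.
have delta0 : 0 <= delta := le_trans (normr_ge0 _) d1_le.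
have d2_le : `|d2| <= delta by exact: QP.
have ed1 : '[e, d1] <= `|e| * delta.
  by rewrite (le_trans (ip_le _ _))// ler_wpM2l.
have ed2 : '[e, d2] <= `|e| * delta.
  by rewrite (le_trans (ip_le _ _))// ler_wpM2l.
have d1sq : `|d1| ^+ 2 <= delta ^+ 2 by rewrite ler_pXn2r ?nnegrE//.
have erem : '[e, 'd Q u h] - '[e, x] <= `|e| * (L / 2 * `|h| ^+ 2).
  by rewrite -ipNr -ipDr (le_trans (ip_le _ _))// ler_wpM2l// distrC.
(* [vmin_u] bounds [(alpha / 2) |h|^2 + '[e, x] + alpha '[u, h]] by
   '[e, d1] + '[e, d2] + |d1|^2 / 2 - |x - d2|^2 / 2; [stat] and [erem]
   bound '[e, x] + alpha '[u, h] from below. *)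
have := sqr_ge0 `|x - d2|.
lra.
Qed.

Theorem theorem2p6 (R : realType) (U H : hilbertType R) (g : H) (alpha : R)
    (alpha_gt0 : 0 < alpha)
    (Cad : set U) (Cad_neq0 : Cad !=set0) (Cad_closed : closed Cad)
    (Cad_convex : convex_set Cad)
    (Q : U -> H) (Qn : nat -> U -> H)
    (Q_wsc : weakly_seq_closed Q)
    (Qn_wsc : forall n, weakly_seq_closed (Qn n))
    (eps : R ^nat)
    (eps_noninc : nonincreasing_seq eps)
    (eps_cvg0 : eps n @[n --> \oo] --> (0 : R))
    (Q_Qn : forall n (u : U), Cad u -> `|Q u - Qn n u| <= eps n)
    (un : U ^nat)
    (un_min : forall n, minimizer_on Cad (tikhonov (Qn n) g alpha) (un n))
    (ubar : U) (ubar_min : minimizer_on Cad (tikhonov Q g alpha) ubar)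
    (Q_diff : forall u : U, differentiable Q u)
    (L1 : R) (L1_gt0 : 0 < L1)
    (dQ_lip : forall ua ub : U, Cad ua -> Cad ub ->
      opnorm ('d Q ua \- 'd Q ub) <= L1 * `|ua - ub|)
    (L1_small : L1 * `|Q ubar - g| < alpha)
    (dJ_eq0 : 'd (tikhonov Q g alpha) ubar = (fun=> 0) :> (U -> R^o)) :
  \forall n \near \oo,
    `|un n - ubar| <=
      Num.sqrt (3 / (alpha - L1 * `|g - Q ubar|)) *
      Num.sqrt (eps n ^+ 2 + 2 * `|Q ubar - g| ^+ 2).
Proof.
apply: nearW => n; rewrite (distrC g).
have est := tikhonov_stability Cad_convex (fun w _ => Q_diff w) (ltW L1_gt0)
  dQ_lip (Q_Qn n) ubar_min (un_min n).
set r := `|Q ubar - g| in est L1_small *; set c := alpha - L1 * r in est *.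
have c0 : 0 < c by rewrite subr_gt0.
rewrite -sqrtrM; last by rewrite divr_ge0// ltW.
rewrite -[leLHS]ger0_norm// -sqrtr_sqr ler_wsqrtr//.
rewrite mulrAC ler_pdivlMr// mulrC (le_trans est)//.
(* [4 r eps <= 2 r^2 + 2 eps^2], and [6 r^2] is available *)
have := sqr_ge0 (eps n - r); have := sqr_ge0 r; lra.
Qed.
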